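(* Let $n\ge1$ and $\mathrm{CS}_n=\{(c_n,\dots,c_1):1\le c_k\le k\text{ for }1\le k\le n\}$ (so $|\mathrm{CS}_n|=n!$). (a) For each $\lambda\in P(n)$, let $\mathrm{Surv}_\lambda$ be the set of triples $(S,S,\sigma)$ such that, for some $\beta\in C(n)$, $S\in\mathrm{RHT}(\lambda,\beta)$, $\sigma\in S_n$ and $\mathrm{cycC}(\sigma)=\beta$. Then there is a bijection $F_\lambda:\mathrm{CS}_n\to\mathrm{Surv}_\lambda$. (b) Let $\mu\in P(n)$ and let $\rho$ be a fixed rim-hook such that $\mathrm{dg}(\mu)\setminus\rho$ is the diagram of a partition. Let $\mathrm{Surv}_{\mu,\rho}$ be the set of pairs $(T,\sigma)$ where $T\in\mathrm{RHT}(\mu,\beta)$ for some $\beta\in C(n)$, the cells of $T$ containing its largest label $\ell(\beta)$ are exactly $\rho$, $\sigma\in S_n$, and $\mathrm{cycC}(\sigma)=\beta$. Then there is a bijection $F_{\mu,\rho}:\mathrm{CS}_{n-1}\to\mathrm{Surv}_{\mu,\rho}$.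
   Context: $P(n)$, $C(n)$: partitions and compositions of $n$; $\mathrm{dg}(\mu)$ is the diagram of left-justified rows of boxes, row $i$ from the top having $\mu_i$ boxes. A rim-hook is a set of boxes that can be traversed starting at some box and successively moving one step right or one step up. $\mathrm{RHT}(\lambda,\beta)$ is the set of fillings of $\mathrm{dg}(\lambda)$ such that for each $k$ the cells containing $k$ form a rim-hook of size $\beta_k$, and the cells containing $1,\dots,k$ form a partition diagram. For $\sigma\in S_n$, the canonical cycle notation writes each cycle starting at its minimum element and lists cycles with their minimum elements in decreasing order; $\mathrm{cycC}(\sigma)$ is the list of cycle lengths (including 1-cycles) in this notation, left to right. $\mathrm{CS}_0$ is the one-element set containing the empty sequence. *)

(* Defs.v *)
From mathcomp Require Import all_boot perm finmap.
From mathcomp Require Import classical_sets functions cardinality.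

Set Implicit Arguments.
Unset Strict Implicit.
Unset Printing Implicit Defensive.

Local Open Scope fset_scope.
Local Open Scope classical_set_scope.
Local Open Scope nat_scope.

Definition composition_of (n : nat) (b : seq nat) : bool :=
  (0 \notin b) && (sumn b == n).

Definition partition_seq (l : seq nat) : bool := sorted geq l && (0 \notin l).
Definition partition_of (n : nat) (l : seq nat) : bool :=
  partition_seq l && (sumn l == n).

(* A box is a pair (row, column), both counted from 0, rows going downwards. *)
Notation box := (nat * nat)%type.

Definition dg (m : seq nat) : {fset box} :=
  [fset c in [seq (i, j) | i <- iota 0 (size m), j <- iota 0 (nth 0 m i)]].

Definition is_diagram (A : {fset box}) : Prop :=
  exists2 m : seq nat, partition_seq m & A = dg m.

Definition step_right_or_up : rel box := fun b c =>
  (c == (b.1, b.2.+1)) || (b == (c.1.+1, c.2)).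

(* In particular a rim-hook is nonempty. *)
Definition rim_hook (A : {fset box}) : Prop :=
  exists (b : box) (p : seq box),
    path step_right_or_up b p /\ A = [fset c in b :: p].

Notation filling l := {ffun dg l -> nat}.

Definition cells (l : seq nat) (S : filling l) (P : pred nat) : {fset box} :=
  [fset val c | c : dg l & P (S c)].

(* The labels are 1, ..., size b; the part b_k is nth 0 b k.-1. *)
Definition RHT (l b : seq nat) : set (filling l) :=
  [set S : filling l | (forall c : dg l, 1 <= S c <= size b) /\
     forall k : nat, 1 <= k <= size b ->
       [/\ rim_hook (cells S (pred1 k)),
           #|` cells S (pred1 k)| = nth 0 b k.-1
         & is_diagram (cells S (fun i => i <= k))]].
Arguments RHT : clear implicits.

(* 'S_n acts on {0, ..., n-1} instead of {1, ..., n}. Since [orbit s i] is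
   [:: i; s i; s (s i); ...], the cycle of s selected for a minimal i starts
   at its minimum. *)
Definition canonical_cycles (n : nat) (s : 'S_n) : seq (seq 'I_n) :=
  [seq fingraph.orbit s i | i : 'I_n <- rev (enum 'I_n)
     & all (fun j : 'I_n => i <= j) (fingraph.orbit s i)].

Definition cycC (n : nat) (s : 'S_n) : seq nat := shape (canonical_cycles s).

(* The tuple is (c_n, ..., c_1), so that c_k sits at position n - k. *)
Definition CS (n : nat) : set (n.-tuple nat) :=
  [set c | forall k : nat, 1 <= k <= n -> 1 <= nth 0 c (n - k) <= k].
Arguments CS : clear implicits.

Definition Surv (n : nat) (l : seq nat) :
    set (filling l * filling l * 'S_n) :=
  [set x | exists (b : seq nat) (S : filling l) (s : 'S_n),
     [/\ composition_of n b, RHT l b S, cycC s = b & x = (S, S, s)]].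
Arguments Surv : clear implicits.

Definition Surv_hook (n : nat) (m : seq nat) (rho : {fset box}) :
    set (filling m * 'S_n) :=
  [set x | exists b : seq nat,
     [/\ composition_of n b, RHT m b x.1,
         cells x.1 (pred1 (size b)) = rho & cycC x.2 = b]].
Arguments Surv_hook : clear implicits.

(* Main.v *)
(* A rim-hook tableau is a smaller one together with a removable rim-hook for
   the largest label, and the last canonical cycle of a permutation is the one
   through the least element, which can be completed in (n-1)...(n-k+1) ways to
   a cycle of length k. So the pairs (T, sigma) whose last rim-hook is a given
   rho of size k number, by induction, (n-1)...(n-k+1) * (n-k)! = (n-1)!
   independently of rho. Removable rim-hooks correspond to the boxes of the
   diagram (the row of the upper end, the column of the lower end), so there are
   n of them, and summing over the last rim-hook gives n * (n-1)! = n!. *)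
Require Import Defs.
From mathcomp Require Import all_boot perm finmap.
From mathcomp Require Import classical_sets functions cardinality.
From mathcomp Require Import zify.

Set Implicit Arguments.
Unset Strict Implicit.
Unset Printing Implicit Defensive.

Local Open Scope fset_scope.
Local Open Scope classical_set_scope.
Local Open Scope nat_scope.

(** * Diagrams and removable rim-hooks *)

Lemma in_dg m (x : box) : (x \in dg m) = (x.2 < nth 0 m x.1).
Proof.
rewrite in_fset /=; apply/allpairsPdep/idP => [[i [j [ _ + ->]]]|lt_x].
  by rewrite mem_iota.
exists x.1, x.2; split; [|by rewrite mem_iota|by case: x {lt_x}].
rewrite mem_iota add0n /=; case: ltnP => // le_x.
by move: lt_x; rewrite nth_default.
Qed.

Lemma card_dg m : #|` dg m| = sumn m.
Proof.
rewrite card_fseq undup_id; last first.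
  by apply: allpairs_uniq_dep => [|i _|[i j] [k l] _ _ [-> ->]] //; exact: iota_uniq.
rewrite size_allpairs_dep -[in RHS](mkseq_nth 0 m) /mkseq.
by congr sumn; apply: eq_map => i; rewrite size_iota.
Qed.

(** Order ideals of boxes: a pointwise form of being a diagram, easy to check after boxes have been
    removed. *)
Definition down_closed (D : {fset box}) : Prop :=
  forall x y : box, x \in D -> y.1 <= x.1 -> y.2 <= x.2 -> y \in D.

Lemma down_closed_dg m : partition_seq m -> down_closed (dg m).
Proof.
move=> /andP[m_sorted _] x y; rewrite !in_dg => x_m le1 le2.
apply: leq_ltn_trans le2 (leq_trans x_m _).
have [lt_x|le_x] := ltnP x.1 (size m); last by rewrite nth_default.
apply: (sorted_leq_nth (leT := geq)) => //.
- by move=> a b c /= ba /leq_trans; apply.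
- by move=> a /=.
- by rewrite inE (leq_ltn_trans le1).
Qed.

Lemma down_closed_bound (D : {fset box}) :
  exists N, forall x : box, x \in D -> (x.1 < N) && (x.2 < N).
Proof.
exists (\max_(x <- D) maxn x.1 x.2).+1 => x xD.
rewrite !ltnS -geq_max.
exact: (@leq_bigmax_seq (nat * nat)%type _ xpredT (fun x => maxn x.1 x.2)).
Qed.

(** The partition is read off from [D]: the length of a row is the first column missing from it, and
    the number of rows is the index of the first empty row. *)
Lemma down_closed_diagram D : down_closed D -> is_diagram D.
Proof.
move=> Ddown; have [N DN] := down_closed_bound D.
have has_len (i : nat) : exists j : nat, (i, j) \notin D.
  by exists N; apply/negP => /DN /=; rewrite ltnn andbF.
pose len i := ex_minn (has_len i).
have lenE i j : (j < len i) = ((i, j) \in D).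
  rewrite /len; case: ex_minnP => k kD kmin; apply/idP/idP => [|ijD].
    by apply: contraTT => /kmin; rewrite leqNgt.
  by rewrite ltnNge; apply: contra kD => le_kj; apply: Ddown ijD _ _.
have has_rows : exists i : nat, len i == 0.
  by exists N; rewrite -leqn0 leqNgt lenE; apply/negP => /DN /=; rewrite ltnn.
pose rows := ex_minn has_rows.
have rowsE i : (i < rows) = (0 < len i).
  rewrite /rows; case: ex_minnP => k k0 kmin; apply/idP/idP => [|i0].
    by rewrite lt0n; apply: contraTneq => /eqP/kmin; rewrite leqNgt.
  rewrite ltnNge; apply: contraL i0 => le_ki; rewrite lenE; apply/negP.
  by move/Ddown => /(_ (k, 0) le_ki isT); rewrite -lenE (eqP k0).
exists (mkseq len rows).
  apply/andP; split.
    apply/(sortedP 0) => i; rewrite size_mkseq => lt_i.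
    rewrite !nth_mkseq ?(ltnW lt_i) //=.
    case E: (len i.+1) => [//|l].
    by rewrite lenE; apply: (Ddown (i.+1, l)) => //=; rewrite -lenE E.
  rewrite /mkseq; apply/negP => /mapP[i]; rewrite mem_iota add0n rowsE /= => + E.
  by rewrite -E.
apply/fsetP => -[i j]; rewrite in_dg /= -lenE.
have [lt_i|le_i] := ltnP i rows; first by rewrite nth_mkseq.
rewrite nth_default ?size_mkseq // ltn0.
by move: le_i; rewrite leqNgt rowsE lt0n negbK => /eqP ->.
Qed.

Lemma is_diagramP D : is_diagram D <-> down_closed D.
Proof. by split=> [[m /down_closed_dg ? ->]|/down_closed_diagram]. Qed.

(** * The rim of a diagram and its removable pieces *)

Definition rim (D : {fset box}) : {fset box} :=
  [fset x in D | (x.1.+1, x.2.+1) \notin D].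

(** For a box [c] of an order ideal, this is the rim-hook from the foot of the column of [c] to the
    end of its row, the rim counterpart of the hook of [c]. *)
Definition rim_from (D : {fset box}) (c : box) : {fset box} :=
  [fset x in rim D | (c.1 <= x.1) && (c.2 <= x.2)].

Definition removable (D rho : {fset box}) : Prop :=
  [/\ rim_hook rho, (rho `<=` D)%fset & is_diagram (D `\` rho)%fset].

Lemma in_rim D (x : box) :
  (x \in rim D) = (x \in D) && ((x.1.+1, x.2.+1) \notin D).
Proof. by rewrite !inE. Qed.

Lemma in_rim_from D c (x : box) :
  (x \in rim_from D c) = [&& x \in rim D, c.1 <= x.1 & c.2 <= x.2].
Proof. by rewrite !inE. Qed.

(* Right if possible, else up, is the only way to stay in the rim. *)
Lemma rim_path D i (x : box) : down_closed D -> x \in rim D -> i <= x.1 ->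
  exists p, path step_right_or_up x p /\
    forall y, (y \in x :: p) =
      [&& y \in rim D, i <= y.1, y.1 <= x.1 & x.2 <= y.2].
Proof.
move=> Ddown; have [N DN] := down_closed_bound D.
(* The measure drops on a step up and, since columns stay below [N], also on a step right. *)
have [d] := ubnP (x.1 + (N - x.2)).
elim: d x => // d IHd [r c] /= lt_d x_rim le_ir.
have := x_rim; rewrite in_rim /= => /andP[xD x1D].
have /= /andP[_ lt_cN] := DN _ xD.
have [rD|rND] := boolP ((r, c.+1) \in D).
  have [|||p [p_path p_mem]] := IHd (r, c.+1) => //=; first by lia.
    rewrite in_rim rD /=; apply: contra x1D => z.
    by apply: Ddown z _ _ => /=; lia.
  exists ((r, c.+1) :: p); split; first by rewrite /= p_path /step_right_or_up eqxx.
  move=> [a b]; rewrite inE p_mem /=.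
  have [[-> ->]|neq] := eqVneq; first by rewrite x_rim le_ir !leqnn.
  case y_rim: ((a, b) \in rim D) => //=; congr (_ && _).
  have [le_ar|//] := leqP a r; rewrite /= ltn_neqAle.
  (* In column [c], a rim box above row [r] is impossible: its diagonal neighbour would be in [D]
     because [(r, c.+1)] is. *)
  suff -> : c != b by [].
  apply/eqP => eq_cb; rewrite -{b}eq_cb in neq y_rim.
  move: neq => /negP; apply; rewrite xpair_eqE eqxx andbT.
  rewrite eqn_leq le_ar leqNgt; apply/negP => lt_ar.
  by move: y_rim; rewrite in_rim /= (Ddown _ (a.+1, c.+1) rD) //= andbF.
have up y : y \in rim D -> y.1 = r -> c <= y.2 -> y = (r, c).
  case: y => a b /= + eq_ar; rewrite {}eq_ar => y_rim le_cb; congr pair; apply/eqP.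
  rewrite eqn_leq le_cb andbT leqNgt; apply: contra rND => lt_cb.
  by move: y_rim; rewrite in_rim => /andP[+ _] => /Ddown; apply=> /=; lia.
have [eq_ir|neq_ir] := eqVneq i r.
  exists [::]; split=> // y; rewrite inE; apply/eqP/and4P => [->|[]].
    by rewrite x_rim eq_ir !leqnn.
  move=> y_rim le_i le_r; apply: up => //; apply/eqP.
  by rewrite eqn_leq le_r -eq_ir.
have [|||p [p_path p_mem]] := IHd (r.-1, c) => //=; try lia.
  rewrite in_rim /= (Ddown _ (r.-1, c) xD) //=; last by lia.
  by rewrite prednK //; lia.
exists ((r.-1, c) :: p); split.
  by rewrite /= p_path /step_right_or_up /= prednK ?eqxx ?orbT //; lia.
move=> y; rewrite inE p_mem /=; apply/orP/and4P => [[/eqP->|/and4P[-> -> le_r ->]]|[]].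
- by rewrite x_rim le_ir !leqnn.
- by split=> //; lia.
- move=> y_rim -> le_r le_c; rewrite y_rim le_c /=.
  have [eq_r|neq_r] := eqVneq y.1 r; first by left; apply/eqP/up.
  by right; rewrite andbT; lia.
Qed.

(** The lowest box of the column is in the rim, since a diagonal neighbour would force a box
    directly below it. *)
Lemma column_foot D c : down_closed D -> c \in D ->
  exists2 r, (r, c.2) \in rim_from D c & (r.+1, c.2) \notin D.
Proof.
case: c => i j /= Ddown ijD; have [N DN] := down_closed_bound D.
have [| |r rD rmax] := @ex_maxnP (fun r => (r, j) \in D) N.
- by exists i.
- by move=> r /DN /= /andP[/ltnW].
have r1D : (r.+1, j) \notin D by apply/negP => /rmax; rewrite ltnn.
exists r => //; rewrite in_rim_from in_rim rD rmax //= leqnn andbT.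
by apply: contra r1D => /Ddown; apply=> /=.
Qed.

Lemma row_end D c : down_closed D -> c \in D ->
  exists l, (c.1, l) \in rim_from D c.
Proof.
case: c => i j /= Ddown ijD; have [N DN] := down_closed_bound D.
have [| |l lD lmax] := @ex_maxnP (fun l => (i, l) \in D) N.
- by exists j.
- by move=> l /DN /= /andP[_ /ltnW].
exists l; rewrite in_rim_from in_rim lD lmax //= leqnn !andbT.
apply/negP => /Ddown down; have /lmax := down (i, l.+1) (leqnSn _) (leqnn _).
by rewrite ltnn.
Qed.

(** The rim path starting at the foot of the column and stopped at the row of [c] traverses this
    set. The rest is an order ideal: if [y] is removed, every box of [D] weakly below and to the
    right of [y] is a rim box too and is removed with it. *)
Lemma removable_rim_from D c : down_closed D -> c \in D ->
  removable D (rim_from D c).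
Proof.
move=> Ddown cD; split.
- have [r] := column_foot Ddown cD.
  rewrite in_rim_from => /and3P[r_rim le_r _] r1D.
  have [p [p_path p_mem]] := rim_path Ddown r_rim le_r.
  exists (r, c.2), p; split=> //; apply/fsetP => y.
  rewrite in_rim_from [in RHS]in_fset /= p_mem /=.
  case y_rim: (y \in rim D) => //=; congr (_ && _).
  (* The upper bound [r] on the rows is automatic: a box below row [r] and weakly right of column
     [c.2] would put [(r.+1, c.2)] into [D]. *)
  have [le_c|] := leqP c.2 y.2; rewrite ?andbF // andbT; apply/esym.
  rewrite leqNgt; apply: contra r1D => lt_r.
  by move: y_rim; rewrite in_rim => /andP[/Ddown + _]; apply.
- by apply/fsubsetP => x; rewrite in_rim_from in_rim => /and3P[/andP[]].
- apply/is_diagramP => x y; rewrite !in_fsetD !in_rim_from !in_rim.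
  move=> /andP[x_rho xD] le1 le2; have yD := Ddown x y xD le1 le2.
  rewrite yD andbT; apply: contra x_rho => /= /and3P[y1D le_c1 le_c2].
  rewrite xD (leq_trans le_c1) // (leq_trans le_c2) // !andbT /=.
  by apply: contra y1D => /Ddown; apply.
Qed.

(** The row end and the column foot of [c] lie in the common set, so [c'] is weakly above and to the
    left of [c]; the situation is symmetric. *)
Lemma rim_from_inj D : down_closed D -> {in D &, injective (rim_from D)}.
Proof.
move=> Ddown; suff le c c' : c \in D -> c' \in D -> rim_from D c = rim_from D c' ->
    (c'.1 <= c.1) && (c'.2 <= c.2).
  move=> [i j] [i' j'] cD c'D eq_c.
  have /= /andP[? ?] := le _ _ cD c'D eq_c.
  have /= /andP[? ?] := le _ _ c'D cD (esym eq_c).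
  by congr pair; apply/eqP; rewrite eqn_leq; apply/andP.
move=> cD c'D eq_c; have [r + _] := column_foot Ddown cD.
have [l] := row_end Ddown cD; rewrite eq_c !in_rim_from /=.
by move=> /and3P[_ -> _] /and3P[_ _ ->].
Qed.

Lemma step_path_le (b : box) p (x : box) : path step_right_or_up b p ->
  x \in b :: p -> (x.1 <= b.1) && (b.2 <= x.2).
Proof.
elim: p b => [|b' p IHp] b /=; first by rewrite inE => _ /eqP->; rewrite !leqnn.
move=> /andP[step p_path]; rewrite inE => /predU1P[->|]; first by rewrite !leqnn.
move=> /(IHp _ p_path) /andP[le1 le2].
by case/orP: step => /eqP e; move: le1 le2; rewrite e /=; lia.
Qed.

Lemma step_path_ge_last (b : box) p (x : box) : path step_right_or_up b p ->
  x \in b :: p -> ((last b p).1 <= x.1) && (x.2 <= (last b p).2).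
Proof.
elim: p b x => [|b' p IHp] b x /=; first by rewrite inE => _ /eqP->; rewrite !leqnn.
move=> /andP[step p_path]; rewrite inE => /predU1P[->|]; last exact: IHp.
have /andP[le1 le2] := IHp _ _ p_path (mem_head _ _).
by case/orP: step => /eqP e; move: le1 le2; rewrite e /=; lia.
Qed.

Lemma step_path_no_diagonal (b : box) p (x y : box) : path step_right_or_up b p ->
  x \in b :: p -> y \in b :: p -> ~~ ((x.1 < y.1) && (x.2 < y.2)).
Proof.
elim: p b x y => [|b' p IHp] b x y.
  by rewrite !inE => _ /eqP-> /eqP->; rewrite !ltnn.
move=> b_path x_p y_p; have := b_path => /= /andP[_ p_path].
have := x_p; rewrite inE => /predU1P[->|x_p'].
  by have := step_path_le b_path y_p; lia.
have := y_p; rewrite inE => /predU1P[->|y_p'].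
  by have := step_path_le b_path x_p; lia.
exact: IHp p_path _ _.
Qed.

(** A rim path cannot bypass [y] inside its bounding rectangle: after a step right [y] would be
    strictly above and left of the next box, after a step up strictly below and right of it, and no
    two rim boxes are so placed. *)
Lemma rim_path_crosses D (b : box) p (y : box) : down_closed D ->
  path step_right_or_up b p -> {subset b :: p <= rim D} -> y \in rim D ->
  (last b p).1 <= y.1 <= b.1 -> b.2 <= y.2 <= (last b p).2 -> y \in b :: p.
Proof.
move=> Ddown; elim: p b => [|b' p IHp] b /=.
  move=> _ _ _ e1 e2; rewrite inE; case: b y e1 e2 => r c [a d] /=.
  by rewrite xpair_eqE; lia.
move=> /andP[step p_path] sub_rim y_rim /andP[le1 le2] /andP[le3 le4].
rewrite inE; have [//|] := eqVneq; rewrite -pair_eqE /pair_eq negb_and => neq.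
have b'_rim : b' \in rim D by apply: sub_rim; rewrite !inE eqxx orbT.
have IH := IHp b' p_path (fun x x_p => sub_rim x (mem_behead (s := b :: _) x_p)) y_rim.
move: y_rim b'_rim; rewrite !in_rim => /andP[yD y1D] /andP[b'D b'1D].
apply: IH; rewrite ?le1 ?le4 ?andbT /=.
- case/orP: step => /eqP e; first by rewrite e.
  rewrite leqNgt; apply: contra b'1D => lt_b'; apply: Ddown yD _ _ => //=.
  by move: lt_b' neq le2 le3; rewrite e /=; lia.
- case/orP: step => /eqP e; last by move: le3; rewrite e.
  rewrite leqNgt; apply: contra y1D => lt_b'; apply: Ddown b'D _ _ => //=.
  by move: lt_b' neq le2 le3; rewrite e /=; lia.
Qed.

Lemma removableP D rho : down_closed D -> removable D rho ->
  exists2 c, c \in D & rho = rim_from D c.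
Proof.
move=> Ddown [[b [p [b_path rhoE]]] /fsubsetP subD /is_diagramP Rdown].
have mem_rho x : (x \in rho) = (x \in b :: p) by rewrite rhoE in_fset.
(* The complement of [rho] is an order ideal, so [rho] is closed downwards and rightwards within
   [D]. *)
have up x y : x \in rho -> y \in D -> x.1 <= y.1 -> x.2 <= y.2 -> y \in rho.
  move=> x_rho yD le1 le2; apply: contraLR x_rho => y_rho.
  by have := Rdown y x; rewrite !inE y_rho yD => /(_ isT le1 le2) /andP[].
have b_rho : b \in rho by rewrite mem_rho mem_head.
pose e := last b p; have e_rho : e \in rho by rewrite mem_rho mem_last.
(* By [up], a diagonal neighbour in [D] would be in [rho], but a path of steps right and up has no
   two diagonal boxes. *)
have sub_rim : {subset b :: p <= rim D}.
  move=> x x_p; rewrite in_rim subD ?mem_rho //=; apply/negP => x1D.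
  have := up x (x.1.+1, x.2.+1); rewrite !mem_rho x_p x1D => /(_ isT isT).
  move=> /(_ (leqnSn _) (leqnSn _)) /(step_path_no_diagonal b_path x_p).
  by rewrite /= !ltnSn.
(* The path climbs from [b] to [e]: take the row of its upper end and the column of its lower
   end. *)
exists (e.1, b.2).
  apply: (Ddown b); rewrite ?subD //=.
  by have /andP[] := step_path_ge_last b_path (mem_head _ _).
apply/fsetP => y; rewrite mem_rho in_rim_from; apply/idP/and3P => /= [y_p|[y_rim le1 le2]].
  rewrite sub_rim //; have /andP[_ ->] := step_path_le b_path y_p.
  by have /andP[-> _] := step_path_ge_last b_path y_p.
have yD : y \in D by move: y_rim; rewrite in_rim => /andP[].
apply: (rim_path_crosses Ddown) => //; rewrite -/e ?le1 ?le2 /=.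
(* A rim box below row [b.1] would put the box under [b] into [D], hence into [rho], yet the path
   never goes below its start. The bound at [e] is dual. *)
- rewrite leqNgt; apply/negP => lt1.
  have := up b (b.1.+1, b.2) b_rho; rewrite mem_rho /= leqnSn leqnn.
  move=> /(_ (Ddown y (_, _) yD lt1 le2) isT isT).
  by move=> /(step_path_le b_path) /=; rewrite ltnn.
- rewrite leqNgt; apply/negP => lt2.
  have := up e (e.1, e.2.+1) e_rho; rewrite mem_rho /= leqnSn leqnn.
  move=> /(_ (Ddown y (_, _) yD le1 lt2) isT isT).
  by move=> /(step_path_ge_last b_path) /=; rewrite -/e ltnn andbF.
Qed.

Lemma enum_removable D : down_closed D ->
  exists s : seq {fset box}, [/\ uniq s, size s = #|` D|
    & forall rho, rho \in s <-> removable D rho].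
Proof.
move=> Ddown; exists (map (rim_from D) D); split; rewrite ?size_map //.
  by rewrite map_inj_in_uniq ?fset_uniq //; exact: rim_from_inj.
move=> rho; split=> [/mapP[c cD ->]|/(removableP Ddown)[c cD ->]].
  exact: removable_rim_from.
exact: map_f.
Qed.

(** * Permutations with given canonical cycle lengths *)

Definition cycC_count (n : nat) (b : seq nat) : nat := #|[pred s : 'S_n | cycC s == b]|.

Definition min_of_cycle n (s : 'S_n) (i : 'I_n) : bool :=
  [forall j : 'I_n, fconnect s i j ==> (i <= j)].

Lemma cycCE n (s : 'S_n) : cycC s =
  [seq fingraph.order s i | i : 'I_n <- rev (enum 'I_n)
     & min_of_cycle s i].
Proof.
rewrite /cycC /canonical_cycles /shape -map_comp.
rewrite (eq_map (g := fingraph.order s)); last by move=> i /=; rewrite size_orbit.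
congr map; apply: eq_filter => i; apply/allP/forallP => le_i j.
  by apply/implyP; rewrite fconnect_orbit => /le_i.
by rewrite -fconnect_orbit; apply/implyP/le_i.
Qed.

(* Cuts the cycle of [ord0] just before its return to [ord0] and inserts [x]
   there, after relabelling by [lift x]: [x] becomes the last entry of the last
   canonical cycle (a new cycle [(ord0)] if [x = ord0]). *)
Definition insert_perm n (x : 'I_n.+1) (s : 'S_n) : 'S_n.+1 :=
  (lift_perm x x s * tperm x ord0)%g.

Lemma insert_perm_id n (x : 'I_n.+1) s : insert_perm x s x = ord0.
Proof. by rewrite permM lift_perm_id tpermL. Qed.

Lemma insert_perm_lift n (x : 'I_n.+1) s i :
  insert_perm x s (lift x i) = if lift x (s i) == ord0 then x else lift x (s i).
Proof.
rewrite permM lift_perm_lift; case: eqP => [->|/eqP neq]; first by rewrite tpermR.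
by rewrite tpermD // ?neq_lift // eq_sym.
Qed.

Lemma insert_perm_inj n : injective (fun y : 'I_n.+1 * 'S_n => insert_perm y.1 y.2).
Proof.
move=> [x s] [x' s'] /= eq_s; have eq_x : x = x'.
  by apply: (@perm_inj _ (insert_perm x s)); rewrite {2}eq_s !insert_perm_id.
rewrite -{x'}eq_x in eq_s *; congr pair; apply/permP => i.
by have /mulIg/permP/(_ (lift x i)) := eq_s; rewrite !lift_perm_lift => /lift_inj.
Qed.

Lemma insert_perm_bij n : bijective (fun y : 'I_n.+1 * 'S_n => insert_perm y.1 y.2).
Proof.
apply: (inj_card_bij (@insert_perm_inj n)).
by rewrite card_prod !card_Sn card_ord factS.
Qed.

Lemma filter_enum_ord_lift n (x : 'I_n.+1) :
  [seq i <- enum 'I_n.+1 | i != x] = map (lift x) (enum 'I_n).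
Proof.
apply: (inj_map val_inj); apply: (irr_sorted_eq ltn_trans ltnn).
- apply: subseq_sorted ltn_trans _ _ (map_subseq _ (filter_subseq _ _)) _.
  by rewrite val_enum_ord iota_ltn_sorted.
- rewrite -map_comp sorted_map; apply: (sub_sorted (e := relpre val ltn)).
    by move=> i j /=; rewrite /bump; lia.
  by rewrite -sorted_map val_enum_ord iota_ltn_sorted.
move=> k; apply/mapP/mapP => -[i] + ->.
  rewrite mem_filter eq_sym => /andP[/unlift_some[j -> _] _].
  by exists (lift x j) => //; rewrite map_f // mem_enum.
move=> /mapP[j _ ->]; exists (lift x j) => //.
by rewrite mem_filter eq_sym neq_lift mem_enum.
Qed.

(** Insertion neither merges nor splits the old cycles. *)
Lemma fconnect_insert_perm n (x : 'I_n.+1) (s : 'S_n) (i j : 'I_n) :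
  fconnect (insert_perm x s) (lift x i) (lift x j) = fconnect s i j.
Proof.
set t := insert_perm x s; apply/idP/idP => [|/iter_findex <-]; last first.
  (* A step of [s] lifts to one step of [t], or to two steps through [x] if its lifted target is
     [ord0]. *)
  elim: (findex _ _ _) => [|k IHk] /=; first exact: connect0.
  apply: connect_trans IHk _; set a := iter k s i.
  have := fconnect1 t (lift x a); rewrite /t insert_perm_lift.
  case: eqP => // -> /connect_trans; apply.
  by rewrite -[X in fconnect _ _ X](insert_perm_id x s) fconnect1.
(* [x] is sent to the image of its predecessor, so that a step of [t] becomes
   at most one step of [s]. *)
pose f y := odflt i (unlift x (if y == x then ord0 else y)).
have f_lift k : f (lift x k) = k.
  by rewrite /f eq_sym (negPf (neq_lift x k)) liftK.
have f_step y : fconnect s (f y) (f (t y)).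
  have [k ->|->] := unliftP x y; last first.
    by rewrite /t insert_perm_id /f eqxx; case: ifP => _; apply: connect0.
  rewrite f_lift /t insert_perm_lift; case: eqP => [z|_]; last first.
    by rewrite f_lift fconnect1.
  by rewrite /f eqxx -z liftK fconnect1.
move=> /iter_findex; set k := findex _ _ _ => xj.
rewrite -[i]f_lift -[j]f_lift -xj; elim: k {xj} => [|k IHk]; first exact: connect0.
exact: connect_trans IHk (f_step _).
Qed.

Lemma fconnect_insert_perm_id n (x : 'I_n.+1) (s : 'S_n) (i z : 'I_n) :
  lift x z = ord0 ->
  fconnect (insert_perm x s) (lift x i) x = fconnect s i z.
Proof.
move=> z0; rewrite same_fconnect1_r; last exact: perm_inj.
by rewrite insert_perm_id -z0 fconnect_insert_perm.
Qed.

Lemma order_insert_perm n (x : 'I_n.+1) (s : 'S_n) (i : 'I_n) :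
  fingraph.order (insert_perm x s) (lift x i) =
  fingraph.order s i + fconnect (insert_perm x s) (lift x i) x.
Proof.
rewrite /fingraph.order -!sum1_card big_mkcond (bigD1_ord x) //= addnC.
rewrite [in RHS]big_mkcond; congr (_ + _).
apply: eq_bigr => j _.
by have -> : (lift x j \in fconnect (insert_perm x s) (lift x i)) = (j \in fconnect s i)
  by exact: fconnect_insert_perm.
Qed.

(** The point [ord0] becomes a fixed point and, being least, comes last; the other cycles are
    relabelled monotonically and keep their lengths and order. *)
Lemma cycC_insert_ord0 n (s : 'S_n) : cycC (insert_perm ord0 s) = rcons (cycC s) 1.
Proof.
set t := insert_perm ord0 s.
have t0 : t ord0 = ord0 by exact: insert_perm_id.
have con0 j : fconnect t ord0 j = (j == ord0).
  apply/idP/eqP => [/iter_findex <-|->]; last exact: connect0.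
  by rewrite iter_fix.
have con_lift0 i : fconnect t (lift ord0 i) ord0 = false.
  by rewrite fconnect_sym ?con0; [rewrite eq_sym (negPf (neq_lift _ _))|exact: perm_inj].
rewrite !cycCE enum_ordSl rev_cons -cats1 filter_cat map_cat -/t /=.
have -> /= : min_of_cycle t ord0.
  by apply/forallP => j; rewrite implybT.
rewrite cats1; congr rcons; last first.
  by rewrite /fingraph.order (fintype.eq_card1 (x := ord0)) // => j; rewrite unfold_in con0.
rewrite -map_rev filter_map -map_comp.
rewrite (eq_map (g := fingraph.order s)); last first.
  by move=> i /=; rewrite order_insert_perm con_lift0 addn0.
congr map; apply: eq_filter => i /=; apply/forallP/forallP => le_i j.
  by have := le_i (lift ord0 j); rewrite fconnect_insert_perm.
have [k ->|->] := unliftP ord0 j; last by rewrite con_lift0.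
by have := le_i k; rewrite fconnect_insert_perm.
Qed.

Lemma cycC_split_ord0 n (s : 'S_n.+1) (F : 'I_n.+1 -> nat) :
  [seq F i | i : 'I_n.+1 <- rev (enum 'I_n.+1) & min_of_cycle s i] =
  rcons [seq F i | i : 'I_n.+1 <- rev (map (lift ord0) (enum 'I_n))
     & min_of_cycle s i] (F ord0).
Proof.
rewrite enum_ordSl rev_cons -cats1 filter_cat map_cat /=.
have -> /= : min_of_cycle s ord0 by apply/forallP => j; rewrite implybT.
by rewrite cats1.
Qed.

(** A nonzero [x] joins the cycle of [ord0], which is the last canonical one, and is not its
    minimum; so only the last length grows. *)
Lemma cycC_insert_neq0 n (x : 'I_n.+2) (s : 'S_n.+1) : x != ord0 ->
  exists b k, cycC s = rcons b k.+1 /\ cycC (insert_perm x s) = rcons b k.+2.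
Proof.
move=> x0; set t := insert_perm x s.
have z0 : lift x ord0 = ord0 by apply: val_inj; rewrite /= /bump leqNgt lt0n x0.
have min_x : ~~ min_of_cycle t x.
  apply/forallPn; exists ord0; rewrite negb_imply -ltnNge lt0n x0 andbT.
  by rewrite -[X in fconnect _ _ X](insert_perm_id x s) fconnect1.
have min_lift i : min_of_cycle t (lift x i) = min_of_cycle s i.
  apply/forallP/forallP => le_i j.
    have := le_i (lift x j); rewrite fconnect_insert_perm => /implyP le_ij.
    by apply/implyP => /le_ij /=; rewrite /bump; lia.
  have [k ->|->] := unliftP x j.
    rewrite fconnect_insert_perm; apply/implyP => /(implyP (le_i k)) /=.
    by rewrite /bump; lia.
  rewrite (fconnect_insert_perm_id _ _ z0); apply/implyP => /(implyP (le_i _)).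
  by rewrite leqn0 => /eqP i0; rewrite (_ : i = ord0) ?z0 //; apply: val_inj.
have filt : filter (min_of_cycle t) (rev (enum 'I_n.+2)) =
    map (lift x) (filter (min_of_cycle s) (rev (enum 'I_n.+1))).
  rewrite !filter_rev map_rev; congr rev.
  rewrite -(eq_filter min_lift) -(filter_map (lift x)) -filter_enum_ord_lift -[RHS]filter_predI.
  by apply: eq_filter => i /=; case: eqVneq => [->|_]; rewrite ?andbT // (negPf min_x).
exists [seq fingraph.order s i | i : 'I_n.+1 <- rev (map (lift ord0) (enum 'I_n))
     & min_of_cycle s i], (fingraph.order s ord0).-1.
rewrite orderSpred !cycCE; split; first exact: cycC_split_ord0.
rewrite [filter _ _]filt -map_comp cycC_split_ord0 /=.
rewrite order_insert_perm (fconnect_insert_perm_id _ _ z0) (connect0 (frel s)) addn1.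
congr rcons; apply/eq_in_map => i; rewrite mem_filter => /andP[/forallP/(_ ord0) min_i].
rewrite mem_rev => /mapP[j _ ij] /=.
rewrite order_insert_perm (fconnect_insert_perm_id _ _ z0).
(* Here [i] is a nonzero cycle minimum, so its cycle avoids [ord0] and does not receive [x]. *)
suff /negPf -> : ~~ fconnect s i ord0 by rewrite addn0.
by apply/negP => /(implyP min_i); rewrite ij.
Qed.

(** * Recursion for the number of permutations with given cycle lengths *)

Lemma cycC_countS n c : cycC_count n.+1 c =
  \sum_(x : 'I_n.+1) #|[pred s : 'S_n | cycC (insert_perm x s) == c]|.
Proof.
rewrite /cycC_count -sum1_card.
rewrite (reindex (fun y : 'I_n.+1 * 'S_n => insert_perm y.1 y.2)) /=; last first.
  exact: onW_bij (insert_perm_bij n).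
under [RHS]eq_bigr => x _ do rewrite -sum1_card.
rewrite pair_big_dep /=; apply: eq_bigl => -[x s] /=.
by rewrite !inE.
Qed.

(** Only the insertion of [ord0] makes a last cycle of length 1. *)
Lemma cycC_countS1 n b : cycC_count n.+1 (rcons b 1) = cycC_count n b.
Proof.
rewrite cycC_countS (bigD1 ord0) //= big1 ?addn0 => [|x x0].
  by apply: eq_card => s; rewrite !inE cycC_insert_ord0 eqseq_rcons eqxx andbT.
apply: eq_card0 => s; rewrite inE.
case: n s x x0 => [|n] s x x0; first by move: x0; rewrite (ord1 x).
have [c [k [_ ->]]] := cycC_insert_neq0 s x0.
by rewrite inE eqseq_rcons andbF.
Qed.

(** A longer last cycle arises exactly from the [n] nonzero choices of the inserted point. *)
Lemma cycC_countS2 n b k :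
  cycC_count n.+1 (rcons b k.+2) = n * cycC_count n (rcons b k.+1).
Proof.
rewrite cycC_countS (bigD1 ord0) //= [X in X + _]eq_card0 => [|s]; last first.
  by rewrite !inE cycC_insert_ord0 eqseq_rcons andbF.
rewrite add0n; under eq_bigr => x x0.
  rewrite (_ : #|_| = cycC_count n (rcons b k.+1)); first over.
  case: n x x0 => [|n] x x0; first by move: x0; rewrite (ord1 x).
  apply: eq_card => s; rewrite !inE.
  have [c [l [-> ->]]] := cycC_insert_neq0 s x0.
  by rewrite !eqseq_rcons !eqSS.
by rewrite sum_nat_const cardC1 card_ord.
Qed.

Lemma cycC_count_rcons n b k :
  cycC_count (n + k).+1 (rcons b k.+1) = (n + k) ^_ k * cycC_count n b.
Proof.
elim: k => [|k IHk]; first by rewrite addn0 cycC_countS1 ffactn0 mul1n.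
by rewrite addnS cycC_countS2 IHk mulnA ffactnS.
Qed.

Lemma cycC_count0 : cycC_count 0 [::] = 1.
Proof.
rewrite /cycC_count (eq_card (B := predT)) ?card_Sn // => s.
by rewrite !inE cycCE (size0nil (size_enum_ord 0)).
Qed.

(** * Rim-hook tableaux *)

(** Extending by 0, which is never a tableau label, lets fillings of different shapes be compared
    box by box. *)
Definition label l (S : filling l) (x : box) : nat :=
  if insub x is Some c then S c else 0.

Lemma label_val l (S : filling l) (c : dg l) : label S (val c) = S c.
Proof. by rewrite /label valK. Qed.

Lemma eq_label l (S T : filling l) :
  (forall x, x \in dg l -> label S x = label T x) -> S = T.
Proof.
by move=> eqST; apply/ffunP => c; rewrite -!label_val eqST // fsvalP.
Qed.

Lemma in_cells l (S : filling l) (P : pred nat) x :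
  (x \in cells S P) = (x \in dg l) && P (label S x).
Proof.
apply/imfsetP/andP => [[c Pc ->]|[x_l]]; first by rewrite fsvalP label_val.
have -> : x = val [` x_l]%fset by [].
by rewrite label_val => Pc; exists [` x_l]%fset.
Qed.

Definition fill l (g : box -> nat) : filling l := [ffun c => g (val c)].

Lemma label_fill l g x : x \in dg l -> label (fill l g) x = g x.
Proof. by move=> x_l; rewrite /label insubT ffunE. Qed.

Definition add_hook m l (S : filling l) (k : nat) : filling m :=
  fill m (fun x => if x \in dg l then label S x else k).

Definition remove_hook l m (T : filling m) : filling l := fill l (label T).

Lemma label_add_hook m l (S : filling l) k x : x \in dg m ->
  label (add_hook m S k) x = if x \in dg l then label S x else k.
Proof. exact: label_fill. Qed.

Lemma add_hookK m l k : (dg l `<=` dg m)%fset ->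
  cancel (fun S : filling l => add_hook m S k) (@remove_hook l m).
Proof.
move=> /fsubsetP sub_lm S; apply: eq_label => x x_l.
by rewrite label_fill // label_add_hook ?sub_lm // x_l.
Qed.

Lemma remove_hookK m l rho (T : filling m) k : dg l = (dg m `\` rho)%fset ->
  cells T (pred1 k) = rho -> add_hook m (remove_hook l T) k = T.
Proof.
move=> dgl rhoE; apply: eq_label => x x_m; rewrite label_add_hook //.
case: ifP => [x_l|]; first by rewrite label_fill.
by rewrite dgl in_fsetD x_m -rhoE in_cells x_m andbT /= => /negbFE /eqP.
Qed.

Lemma cells_add_hook m l rho (S : filling l) k (P : pred nat) :
  (rho `<=` dg m)%fset -> dg l = (dg m `\` rho)%fset ->
  cells (add_hook m S k) P = if P k then (cells S P `|` rho)%fset else cells S P.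
Proof.
move=> /fsubsetP sub_rho dgl; apply/fsetP => x; rewrite in_cells.
transitivity ((x \in cells S P) || P k && (x \in rho)); last first.
  by case: (P k); rewrite ?in_fsetU ?orbF.
rewrite in_cells; case x_m: (x \in dg m); last first.
  rewrite dgl in_fsetD x_m !andbF /=; case x_rho: (x \in rho); rewrite ?andbF //.
  by rewrite sub_rho in x_m.
by rewrite label_add_hook // dgl in_fsetD x_m andbT; case: (x \in rho); rewrite ?andbT ?andbF ?orbF.
Qed.

Lemma cells_add_hook_last m l rho (S : filling l) N :
  (rho `<=` dg m)%fset -> dg l = (dg m `\` rho)%fset -> (forall c, S c < N) ->
  cells (add_hook m S N) (pred1 N) = rho.
Proof.
move=> sub_rho dgl S_lt; rewrite (cells_add_hook _ _ _ sub_rho dgl) /= eqxx.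
apply/fsetP => x; rewrite in_fsetU in_cells.
case: (boolP (x \in dg l)) => //= x_l; rewrite /label insubT /=.
by rewrite ltn_eqF.
Qed.

(** The bound on [S] makes the new label fresh, so it occupies exactly [rho]. Smaller labels keep
    their cells, and the last label only adds the conditions on [rho] itself. *)
Lemma RHT_add_hook m l rho (S : filling l) b k :
  partition_seq m -> rim_hook rho -> (rho `<=` dg m)%fset ->
  dg l = (dg m `\` rho)%fset -> (forall c, S c <= size b) ->
  RHT m (rcons b k) (add_hook m S (size b).+1) <-> RHT l b S /\ k = #|` rho|.
Proof.
move=> m_part rho_hook sub_rho dgl S_le.
have mem_l x : (x \in dg l) = (x \notin rho) && (x \in dg m) by rewrite dgl in_fsetD.
pose T := add_hook m S (size b).+1.
have cellsT P : cells T P = _ := cells_add_hook S _ P sub_rho dgl.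
have cells_lt P : ~~ P (size b).+1 -> cells T P = cells S P.
  by rewrite cellsT => /negPf ->.
have cells_last : cells T (pred1 (size b).+1) = rho.
  exact: cells_add_hook_last.
have cells_all : cells T (fun i => i <= (size b).+1) = dg m.
  rewrite cellsT leqnn; apply/fsetP => x; rewrite in_fsetU in_cells.
  rewrite dgl in_fsetD; case x_rho: (x \in rho); first by rewrite orbT (fsubsetP sub_rho).
  case x_m: (x \in dg m); rewrite //= orbF.
  rewrite /label insubT; first by rewrite dgl in_fsetD x_rho.
  by move=> x_l; rewrite /= ltnW // ltnS S_le.
split=> [[]|[[S_lab S_cells] ->]]; first rewrite size_rcons => T_lab T_cells.
- split; first split.
  + move=> c; rewrite S_le andbT -label_val.
    have c_m : val c \in dg m by have := fsvalP c; rewrite mem_l => /andP[].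
    have := T_lab [` c_m]%fset; rewrite -label_val /= label_add_hook // fsvalP.
    by case/andP.
  + move=> j /andP[j0 le_jb]; have [] := T_cells j; first by rewrite j0 leqW.
    rewrite !cells_lt /= -?ltnNge ?gtn_eqF //.
    by rewrite nth_rcons prednK // le_jb.
  + have [] := T_cells (size b).+1; first by rewrite leqnn.
    by rewrite cells_last nth_rcons ltnn eqxx.
- split.
  + move=> c; rewrite size_rcons -label_val label_add_hook ?fsvalP //.
    case: ifP => [c_l|_]; last by rewrite leqnn.
    have := S_lab [` c_l]%fset; rewrite -label_val /= => /andP[-> ?].
    by rewrite leqW.
  + move=> j; rewrite size_rcons => /andP[j0]; rewrite leq_eqVlt => /predU1P[->|].
      rewrite cells_last cells_all nth_rcons ltnn eqxx; split=> //.
      by exists m.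
    rewrite ltnS => le_jb; rewrite !cells_lt /= -?ltnNge ?gtn_eqF //.
    rewrite nth_rcons prednK // le_jb; apply: S_cells.
    by rewrite j0.
Qed.

Lemma RHT_last_removable m b k (T : filling m) : RHT m (rcons b k) T ->
  removable (dg m) (cells T (pred1 (size b).+1)) /\
  (dg m `\` cells T (pred1 (size b).+1))%fset = cells T (fun i => i <= size b).
Proof.
case; rewrite size_rcons => T_lab T_cells.
have dgD : (dg m `\` cells T (pred1 (size b).+1))%fset = cells T (fun i => i <= size b).
  apply/fsetP => x; rewrite in_fsetD !in_cells.
  case: (boolP (x \in dg m)) => [x_m|_]; rewrite ?andbF //= andbT.
  have := T_lab [` x_m]%fset; rewrite -label_val /=; lia.
split=> //; split; last 1 first.
(* The tableau condition starts at label 1, so for a single hook the empty remainder is treated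
   separately. *)
- rewrite dgD; case: (posnP (size b)) => [->|b0]; last first.
    by case: (T_cells (size b)) => //; rewrite b0 leqnSn.
  exists [::] => //; apply/fsetP => x; rewrite in_cells [RHS]in_dg nth_nil.
  apply/negP => /andP[x_m]; have := T_lab [` x_m]%fset; rewrite -label_val /=.
  lia.
- by case: (T_cells (size b).+1); rewrite ?leqnn.
- by apply/fsubsetP => x; rewrite in_cells => /andP[].
Qed.

(** * Weighted enumeration of tableaux by their last hook *)

Definition tableaux (n : nat) (m : seq nat) : set (filling m * seq nat) :=
  [set x | composition_of n x.2 /\ RHT m x.2 x.1].
Arguments tableaux : clear implicits.

Definition last_hook m (x : filling m * seq nat) : {fset box} :=
  cells x.1 (pred1 (size x.2)).

(* [A] is finite and the pairs [(t, s)] with [(t, cycC s) \in A] number [N]. *)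
Definition has_weight (n : nat) (T : eqType) (A : set (T * seq nat)) (N : nat) : Prop :=
  exists L : seq (T * seq nat), [/\ uniq L, forall x, x \in L <-> A x
    & \sum_(x <- L) cycC_count n x.2 = N].

(** Fibres over distinct values are disjoint, so their lists concatenate and their weights add. *)
Lemma has_weight_fibers n (T K : eqType) (A : set (T * seq nat))
    (f : T * seq nat -> K) (s : seq K) N :
  uniq s -> (forall k, k \in s -> has_weight n (A `&` [set x | f x = k]) N) ->
  has_weight n (A `&` [set x | f x \in s]) (size s * N).
Proof.
elim: s => [_ _|k s IHs /= /andP[ks s_uniq] wA].
  by exists [::]; rewrite big_nil; split=> // x; split=> // -[].
have [|L [L_uniq memL sumL]] := IHs s_uniq.
  by move=> j js; apply: wA; rewrite inE js orbT.
have [|L' [L'_uniq memL' sumL']] := wA k; first exact: mem_head.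
exists (L' ++ L); split; last by rewrite big_cat /= sumL sumL'.
- rewrite cat_uniq L'_uniq L_uniq andbT; apply/hasPn => x /memL [_ /= fx].
  by apply/negP => /memL' [_ /= fk]; rewrite -fk fx in ks.
- move=> x; rewrite mem_cat; split.
    case/orP => [/memL' [Ax /= ->]|/memL [Ax /= fx]]; split=> //=; rewrite inE ?eqxx //.
    by rewrite fx orbT.
  case=> Ax /=; rewrite inE => /predU1P[fx|fx]; apply/orP; [left|right].
    exact/memL'.
  exact/memL.
Qed.

(** Tableaux ending in [rho] correspond to those of the remaining shape [l]. The induction
    hypothesis is an explicit premise, so that the result serves both inside the induction and for
    part (b). *)
Lemma has_weight_removable n m rho : partition_of n m -> removable (dg m) rho ->
  (forall n' l, n' < n -> partition_of n' l -> has_weight n' (tableaux n' l) n'`!) ->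
  has_weight n (tableaux n m `&` [set x | last_hook x = rho]) n.-1`!.
Proof.
move=> /andP[m_part /eqP m_sum] [rho_hook sub_rho [l l_part /esym dgl]] IHn.
have sub_lm : (dg l `<=` dg m)%fset by rewrite dgl fsubDset fsubsetUr.
have mem_l x : (x \in dg l) = (x \notin rho) && (x \in dg m) by rewrite dgl in_fsetD.
have [k card_rho] : exists k, #|` rho| = k.+1.
  case: rho_hook => [c [p [_ ->]]]; exists #|` [fset x in c :: p]|.-1.
  by rewrite prednK // cardfs_gt0; apply/fset0Pn; exists c; rewrite in_fset /= mem_head.
have def_n : n = (sumn l + k).+1.
  rewrite -addnS -card_rho -card_dg dgl cardfsDS // -m_sum -card_dg subnK //.
  exact: fsubset_leq_card.
have lt_n : sumn l < n by rewrite def_n ltnS leq_addr.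
have [|L [L_uniq memL sumL]] := IHn _ l lt_n; first by rewrite /partition_of l_part eqxx.
pose g (x : filling l * seq nat) := (add_hook m x.1 (size x.2).+1, rcons x.2 k.+1).
exists (map g L); split.
- rewrite map_inj_uniq // => -[S b] [S' b'] [+ /rcons_inj[eq_b]].
  by rewrite /= eq_b => /(can_inj (add_hookK _ sub_lm)) ->.
- move=> [T b]; split=> [/mapP[[S c] /memL [/= /andP[c0 /eqP c_sum] S_RHT] [-> ->]]|].
    have S_le x : S x <= size c by case: S_RHT => /(_ x) /andP[].
    split; last by rewrite /last_hook /= size_rcons; exact: cells_add_hook_last.
    split; last exact/(RHT_add_hook _ m_part rho_hook sub_rho dgl).
    by rewrite /composition_of /= mem_rcons inE negb_or c0 sumn_rcons c_sum addnS def_n eqxx.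
  case=> -[/= /andP[b0 /eqP b_sum] T_RHT] /=; rewrite /last_hook /=.
  case/lastP: b => [|b j] in b0 b_sum T_RHT *; first by rewrite -b_sum in lt_n.
  rewrite size_rcons => T_last.
  have T_eq := remove_hookK dgl T_last; set S := remove_hook l T in T_eq.
  have S_le c : S c <= size b.
    rewrite -label_val label_fill ?fsvalP //; have := fsvalP c.
    rewrite mem_l => /andP[c_rho c_m].
    have [/(_ [` c_m]%fset) + _] := T_RHT; rewrite -label_val /= size_rcons => /andP[_].
    rewrite leq_eqVlt ltnS => /predU1P[c_lab|//].
    by rewrite -T_last in_cells c_m /= c_lab eqxx in c_rho.
  rewrite -T_eq in T_RHT *.
  have [S_RHT eq_j] := (RHT_add_hook _ m_part rho_hook sub_rho dgl S_le).1 T_RHT.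
  apply/mapP; exists (S, b); last by rewrite /g /= eq_j card_rho.
  apply/memL; split=> //=; move: b0 b_sum; rewrite mem_rcons inE negb_or.
  rewrite sumn_rcons /composition_of eq_j card_rho => /andP[_ ->] /=; lia.
- rewrite big_map /= def_n; under eq_bigr do rewrite cycC_count_rcons.
  (* With [n.-1 = sumn l + k], the falling factorial of length [k] times [(sumn l)!] is [n.-1!]. *)
  by rewrite -big_distrr /= sumL -[X in X`!](addnK k) ffact_fact // leq_addl.
Qed.

Lemma has_weight_tableaux n m : partition_of n m -> has_weight n (tableaux n m) n`!.
Proof.
have [N] := ubnP n; elim: N n m => // N IHN [|n] m lt_nN m_part.
  have -> : m = [::].
    case/andP: m_part => /andP[_]; case: m => // a m; rewrite inE negb_or eq_sym.
    by move=> /andP[a0 _] /=; rewrite addn_eq0 (negPf a0).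
  exists [:: ([ffun=> 0], [::])]; split=> //; last by rewrite big_seq1 cycC_count0.
  have no_cell (c : dg [::]) : False by have := fsvalP c; rewrite in_dg nth_nil.
  move=> [S b]; rewrite inE; split=> [/eqP[-> ->]|[/= /andP[b0 b_sum] _]].
    by split=> //; split=> [c|[]//]; case: (no_cell c).
  case: b => [|a b] in b0 b_sum *.
    by apply/eqP; congr pair; apply/ffunP => c; case: (no_cell c).
  by move: b0 b_sum; rewrite inE negb_or eq_sym /= addn_eq0 => /andP[/negPf ->].
have [s [s_uniq s_size mem_s]] := enum_removable (down_closed_dg (proj1 (andP m_part))).
(* The restriction is vacuous, since every last hook is removable; it splits the set into [n.+1]
   fibres of weight [n!] each. *)
have -> : tableaux n.+1 m = tableaux n.+1 m `&` [set x | last_hook x \in s].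
  apply/seteqP; split=> [[T b] [/= b_comp T_RHT]|x []//]; split=> //=.
  apply/mem_s; rewrite /last_hook /=.
  case/lastP: b => [|b k] in b_comp T_RHT *; first by [].
  by rewrite size_rcons; have [] := RHT_last_removable T_RHT.
have -> : n.+1`! = size s * n`!.
  by rewrite s_size card_dg; case/andP: m_part => _ /eqP ->.
apply: has_weight_fibers => // rho /mem_s rho_rem.
apply: (has_weight_removable m_part rho_rem) => n' l lt_n'.
by apply: IHN; apply: leq_trans lt_n' _.
Qed.

(** * Bijections *)

Definition has_card (T : eqType) (A : set T) (N : nat) : Prop :=
  exists s : seq T, [/\ uniq s, forall x, x \in s <-> A x & size s = N].

Lemma has_card_bij (T U : eqType) (y0 : U) (A : set T) (B : set U) N :
  has_card A N -> has_card B N -> exists F : T -> U, set_bij A B F.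
Proof.
move=> [s [s_uniq mem_s s_size]] [t [t_uniq mem_t t_size]].
(* Elements at equal positions are matched; outside [A] the value is the default [y0]. *)
exists (fun x => nth y0 t (index x s)); split.
- move=> x /mem_s x_s; apply/mem_t/mem_nth.
  by rewrite t_size -s_size index_mem.
- move=> x y; rewrite !inE => /mem_s x_s /mem_s y_s /eqP.
  by rewrite nth_uniq ?t_size -?s_size ?index_mem // => /eqP /(congr1 (nth x s)); rewrite !nth_index.
- move=> y /mem_t y_t; have lt_y : index y t < size s by rewrite s_size -t_size index_mem.
  case: s lt_y s_uniq mem_s {s_size} => // x0 s lt_y s_uniq mem_s.
  exists (nth x0 (x0 :: s) (index y t)); first by apply/mem_s/mem_nth.
  by rewrite index_uniq // nth_index.
Qed.

Lemma has_card_ordinal N : has_card `I_N N.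
Proof. by exists (iota 0 N); rewrite iota_uniq size_iota; split=> // x; rewrite mem_iota. Qed.

Lemma has_card_CS n : has_card (CS n) n`!.
Proof.
elim: n => [|n [s [s_uniq mem_s s_size]]].
  exists [:: [tuple]]; split=> // t; rewrite tuple0 inE eqxx; split=> // _.
  by move=> k /andP[k0 /(leq_trans k0)].
pose g i (t : n.-tuple nat) := [tuple of i :: t].
have mem_r i : (i \in iota 1 n.+1) = (0 < i <= n.+1) by rewrite mem_iota.
(* The list [r] is the range of the new leading entry, the one of index [n.+1]. *)
move: (iota 1 n.+1) (iota_uniq 1 n.+1) (size_iota 1 n.+1) mem_r => r r_uniq r_size mem_r.
exists [seq g i t | i <- r, t <- s]; split.
- rewrite allpairs_uniq // => -[i t] [j u] _ _ /= [-> eq_tu].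
  by congr pair; apply: val_inj.
- move=> t; split=> [/allpairsP[[i u] /= [i_le /mem_s u_CS ->]] k /andP[k0]|t_CS].
    rewrite leq_eqVlt => /predU1P[->|]; first by rewrite subnn /= -mem_r.
    rewrite ltnS => le_kn; rewrite subSn //=; apply: u_CS.
    by rewrite k0.
  apply/allpairsP; exists (thead t, behead_tuple t); split=> /=.
  + rewrite mem_r; have := t_CS n.+1; rewrite subnn ltnS leqnn => /(_ isT).
    by rewrite (tuple_eta t).
  + apply/mem_s => k /andP[k0 le_kn]; have := t_CS k; rewrite k0 leqW // subSn // => /(_ isT).
    by rewrite (tuple_eta t).
  + exact: tuple_eta.
- by rewrite size_allpairs r_size s_size factS.
Qed.

(** Each listed pair is expanded into all permutations with its cycle lengths, which is what its
    weight counts. *)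
Lemma has_weight_card n (T : eqType) (A : set (T * seq nat)) N :
  has_weight n A N -> has_card [set x : T * 'S_n | A (x.1, cycC x.2)] N.
Proof.
move=> [L [L_uniq memL sumL]].
pose perms b := enum [pred s : 'S_n | cycC s == b].
exists [seq (x.1, s) | x <- L, s <- perms x.2]; split.
- apply: allpairs_uniq_dep => [//|x _|]; first exact: enum_uniq.
  move=> _ _ /allpairsPdep[[S b] [s [_ + ->]]] /allpairsPdep[[S' b'] [s' [_ + ->]]].
  by rewrite !mem_enum !inE => /= /eqP <- /eqP <- [-> ->].
- move=> [S s]; split=> [/allpairsPdep[[T' b] [s' [/memL Lx + [-> ->]]]]|/= /memL Lx].
    by rewrite mem_enum inE => /eqP /= ->.
  apply/allpairsPdep; exists (S, cycC s), s; split=> //.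
  by rewrite mem_enum inE /=.
- rewrite size_allpairs_dep sumnE big_map -sumL; apply: eq_bigr => x _.
  by rewrite /cycC_count cardE.
Qed.

Lemma has_card_image (T U : eqType) (f : T -> U) (A : set T) (B : set U) N :
  injective f -> (forall y, B y <-> exists2 x, A x & y = f x) ->
  has_card A N -> has_card B N.
Proof.
move=> f_inj BE [s [s_uniq mem_s s_size]].
exists (map f s); rewrite map_inj_uniq ?size_map //; split=> // y; rewrite BE.
by split=> [/mapP|] [x] /mem_s Ax ->; [exists x|apply: map_f].
Qed.

(** The composition is determined by the permutation, and the second copy of the tableau by the
    first. *)
Lemma has_card_Surv n l : partition_of n l -> has_card (Surv n l) n`!.
Proof.
move=> /has_weight_tableaux/has_weight_card.
apply: (has_card_image (f := fun x => (x.1, x.1, x.2))) => [[S s] [S' s'] [-> _ ->]//|y].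
split=> [[b [S [s [b_comp S_RHT sb ->]]]]|[[S s] [/= b_comp S_RHT] ->]].
  by exists (S, s) => //=; rewrite sb.
by exists (cycC s), S, s.
Qed.

Lemma has_card_Surv_hook n m rho : partition_of n m -> removable (dg m) rho ->
  has_card (Surv_hook n m rho) n.-1`!.
Proof.
move=> m_part rho_rem.
have /has_weight_card := has_weight_removable m_part rho_rem
  (fun n' l _ => @has_weight_tableaux n' l).
apply: (has_card_image (f := id)) => // -[S s].
split=> [[b [b_comp S_RHT S_last sb]]|[[S' s'] [[b_comp S_RHT] S_last] ->]].
  by exists (S, s) => //; rewrite -sb in b_comp S_RHT S_last.
by exists (cycC s').
Qed.

Theorem theorem7p4 (n : nat) (n_ge1 : 1 <= n) :
  [/\ (CS n #= `I_(n`!))%card,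
      forall lambda : seq nat, partition_of n lambda ->
        exists F : n.-tuple nat -> filling lambda * filling lambda * 'S_n,
          set_bij (CS n) (Surv n lambda) F
    & forall (mu : seq nat) (rho : {fset box}),
        partition_of n mu ->
        rim_hook rho -> (rho `<=` dg mu)%fset ->
        is_diagram (dg mu `\` rho)%fset ->
        exists F : n.-1.-tuple nat -> filling mu * 'S_n,
          set_bij (CS n.-1) (Surv_hook n mu rho) F].
Proof.
split=> [|l l_part|m rho m_part rho_hook sub_rho rho_diag].
- have [F] := has_card_bij 0 (has_card_CS n) (has_card_ordinal n`!).
  by move=> F_bij; apply/card_set_bijP; exists F.
- apply: (has_card_bij ([ffun=> 0], [ffun=> 0], 1%g)) (has_card_CS n) _.
  exact: has_card_Surv.
- apply: (has_card_bij ([ffun=> 0], 1%g)) (has_card_CS n.-1) _.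
  exact: has_card_Surv_hook.
Qed.
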